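(* Let $H$ be a topological group, $G\subseteq H$ a subgroup with the subspace topology, and $\mathbb{X}$ a regular topological space. Let $m$ be a continuous partial action of $G$ on $\mathbb{X}$ such that $G*\mathbb{X}$ is open in $G\times\mathbb{X}$. Let $\hat m^H$ be the associated partial action of $G$ on $H\times\mathbb{X}$, and let $\widehat{E}^p_H$ be its orbit equivalence relation on $H\times\mathbb{X}$. Then the quotient space $(H\times\mathbb{X})/\widehat{E}^p_H$ is regular under any of the following conditions: (1) $\mathbb{X}_g$ is closed in $\mathbb{X}$ for all $g\in G$; (2) $\mathbb{X}$ is a locally compact metric space and $\widehat{E}^p_G$ is closed in $(G\times\mathbb{X})^2$; (3) $\mathbb{X}$ is compact Hausdorff and $\widehat{E}^p_G$ is closed in $(G\times\mathbb{X})^2$.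
   Context: A partial action of a group $G$ (identity $1$) on a set $\mathbb{X}$ is a partially defined function $m$ from $G\times\mathbb{X}$ to $\mathbb{X}$, written $(g,x)\mapsto g\cdot x$, such that for all $g,h\in G$, $x\in\mathbb{X}$: (PA1) if $g\cdot x$ is defined then $g^{-1}\cdot(g\cdot x)$ is defined and equals $x$; (PA2) if $g\cdot(h\cdot x)$ is defined then $(gh)\cdot x$ is defined and $g\cdot(h\cdot x)=(gh)\cdot x$; (PA3) $1\cdot x$ is defined and equals $x$. Put $G*\mathbb{X}=\{(g,x)\in G\times\mathbb{X}: g\cdot x \text{ is defined}\}$, $\mathbb{X}_{g^{-1}}=\{x\in\mathbb{X}: g\cdot x\text{ is defined}\}$, and let $m_g:\mathbb{X}_{g^{-1}}\to\mathbb{X}_g$, $x\mapsto g\cdot x$ (a bijection). For a topological group $G$ and a topological space $\mathbb{X}$, the partial action is topological if each $\mathbb{X}_g$ is open in $\mathbb{X}$ and each $m_g$ is a homeomorphism; it is continuous if moreover $m:G*\mathbb{X}\to\mathbb{X}$ is continuous, where $G*\mathbb{X}$ has the subspace topology of the product. For $G$ a subgroup of $H$, the partial action $\hat m^H$ of $G$ on $H\times\mathbb{X}$ is: for $g\in G$ and $(h,x)\in H\times\mathbb{X}$, $g\cdot(h,x)$ is defined iff $x\in\mathbb{X}_{g^{-1}}$, and then $g\cdot(h,x)=(hg^{-1},g\cdot x)$. The orbit equivalence relation of a partial action of $G$ relates $z$ to $w$ iff there is $g\in G$ with $g\cdot z$ defined and $g\cdot z=w$. $\widehat{E}^p_G$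 denotes the orbit equivalence relation on $G\times\mathbb{X}$ of $\hat m=\hat m^G$ (the case $H=G$). Quotients carry the quotient topology. Regular means that a point and a closed set not containing it can be separated by disjoint open sets ($T_1$ is not included). *)

(* Defs.v *)
From HB Require Import structures.
From mathcomp Require Import all_boot all_order all_algebra.
From mathcomp Require Import all_classical all_reals all_analysis.

Set Implicit Arguments.
Unset Strict Implicit.
Unset Printing Implicit Defensive.

Import Order.TTheory GRing.Theory Num.Theory.

Local Open Scope classical_set_scope.
Local Open Scope group_scope.
Local Open Scope quotient_scope.

HB.mixin Record isTopologicalGroup G & Topological G & Group G := {
  mulg_continuous : continuous (fun p : G * G => p.1 * p.2) ;
  invg_continuous : continuous (fun x : G => x^-1)
}.

#[short(type="topologicalGroupType")]
HB.structure Definition TopologicalGroup :=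
  { G of Topological G & Group G & isTopologicalGroup G }.

Section Subgroup.
Variables (H : topologicalGroupType) (G : groupClosed H).

Definition subgroup : Type := {x : H | x \in G}.

HB.instance Definition _ := SubChoice.copy subgroup {x : H | x \in G}.

Let subgroup_closed : group_closed G.
Proof. by split; [exact: gpred1 | exact: gpredF]. Qed.

HB.instance Definition _ :=
  SubChoice_isSubGroup.Build H _ subgroup subgroup_closed.
HB.instance Definition _ :=
  Topological.copy subgroup (initial_topology (val : subgroup -> H)).

Let val_continuous : continuous (val : subgroup -> H).
Proof. exact: initial_continuous. Qed.

Let subgroup_continuous (T : topologicalType) (f : T -> subgroup) :
  continuous (val \o f : T -> H) -> continuous f.
Proof. exact: continuous_comp_initial. Qed.

Let subgroup_mulg_continuous :
  continuous (fun p : subgroup * subgroup => p.1 * p.2).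
Proof.
apply: subgroup_continuous => p.
rewrite (_ : val \o _ = fun p : subgroup * subgroup => val p.1 * val p.2);
  last by apply/funext => q; exact: valM.
apply: (@continuous_comp _ _ _
  (fun p : subgroup * subgroup => (val p.1, val p.2))
  (fun p : H * H => p.1 * p.2)); last exact: mulg_continuous.
apply: cvg_pair => /=.
  apply: (@continuous_comp _ _ _ fst); [exact: cvg_fst | exact: val_continuous].
apply: (@continuous_comp _ _ _ snd); [exact: cvg_snd | exact: val_continuous].
Qed.

Let subgroup_invg_continuous : continuous (fun x : subgroup => x^-1).
Proof.
apply: subgroup_continuous => x.
rewrite (_ : val \o _ = fun x : subgroup => (val x)^-1);
  last by apply/funext => y; exact: gmulfV.
apply: continuous_comp; [exact: val_continuous | exact: invg_continuous].
Qed.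

HB.instance Definition _ := isTopologicalGroup.Build subgroup
  subgroup_mulg_continuous subgroup_invg_continuous.

End Subgroup.

(* [pact m g x = Some y] means that g . x is defined and equals y. *)
Record partial_action (G : groupType) (X : Type) := PartialAction {
  pact :> G -> X -> option X ;
  pactV : forall g x y, pact g x = Some y -> pact g^-1 y = Some x ;
  pactM : forall g h x y z,
    pact h x = Some y -> pact g y = Some z -> pact (g * h) x = Some z ;
  pact1 : forall x, pact 1 x = Some x
}.

Section PartialActionTheory.
Variables (G : groupType) (X : Type) (m : partial_action G X).

(* G * X *)
Definition pact_dom : set (G * X) := [set p | isSome (m p.1 p.2)].

(* X_g, the set of the x such that g^-1 . x is defined *)
Definition pact_set (g : G) : set X := [set x | isSome (m g^-1 x)].

(* Total extensions of m and m_g; only their restrictions to [pact_dom] and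
   [pact_set g^-1] are meaningful. *)
Definition pact_map (p : G * X) : X := odflt p.2 (m p.1 p.2).
Definition pact_map_at (g : G) (x : X) : X := pact_map (g, x).

Definition orbit_rel (z w : X) : Prop := exists g : G, m g z = Some w.

Let orbit_relb : rel X := fun z w => `[< orbit_rel z w >].

Let orbit_relb_refl : reflexive orbit_relb.
Proof. by move=> z; apply/asboolP; exists 1; exact: pact1. Qed.

Let orbit_relb_sym : symmetric orbit_relb.
Proof.
by move=> z w; apply/asboolP/asboolP => -[g gzw]; exists g^-1; exact: pactV.
Qed.

Let orbit_relb_trans : transitive orbit_relb.
Proof.
move=> y x z /asboolP[g gxy] /asboolP[h hyz]; apply/asboolP.
by exists (h * g); exact: pactM gxy hyz.
Qed.

Definition orbit_equiv : equiv_rel X :=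
  EquivRel orbit_relb orbit_relb_refl orbit_relb_sym orbit_relb_trans.

End PartialActionTheory.

Definition orbit_space (G : groupType) (Z : topologicalType)
    (m : partial_action G Z) : topologicalType :=
  quotient_topology {eq_quot (orbit_equiv m)}.

(* f restricts to a homeomorphism from A onto B *)
Definition homeomorphism_on (T U : topologicalType) (A : set T) (B : set U)
    (f : T -> U) : Prop :=
  [/\ set_bij A B f, {within A, continuous f} &
    exists2 f' : U -> T,
      forall x, A x -> f' (f x) = x & {within B, continuous f'}].

Section TopologicalPartialAction.
Variables (G : topologicalGroupType) (X : topologicalType).
Variable m : partial_action G X.

Definition topological_paction : Prop :=
  (forall g, open (pact_set m g)) /\
  (forall g,
    homeomorphism_on (pact_set m g^-1) (pact_set m g) (pact_map_at m g)).

Definition continuous_paction : Prop :=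
  topological_paction /\ {within pact_dom m, continuous (pact_map m)}.

End TopologicalPartialAction.

(* g . (k, x) = (k (iota g)^-1, g . x), for a group morphism iota : G -> K; the
   inclusion of a subgroup G of K gives \hat m^K, and the identity of G gives
   \hat m. *)
Section HatAction.
Variables (G K : groupType) (X : Type).
Variables (iota : UMagmaMorphism.type G K) (m : partial_action G X).

Let hat_fun (g : G) (p : K * X) : option (K * X) :=
  omap (pair (p.1 * (iota g)^-1)) (m g p.2).

Let hat_funV g p q : hat_fun g p = Some q -> hat_fun g^-1 q = Some p.
Proof.
case: p q => [k x] [l y]; rewrite /hat_fun /=.
case E: (m g x) => [z|] //= [<- <-].
by rewrite (pactV E) /= gmulfV invgK mulgVK.
Qed.

Let hat_funM g h p q r :
  hat_fun h p = Some q -> hat_fun g q = Some r -> hat_fun (g * h) p = Some r.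
Proof.
case: p q r => [k x] [l y] [n z]; rewrite /hat_fun /=.
case E: (m h x) => [u|] //= [<- <-].
case F: (m g u) => [v|] //= [<- <-].
by rewrite (pactM E F) /= gmulfM invgM mulgA.
Qed.

Let hat_fun1 p : hat_fun 1 p = Some p.
Proof. by case: p => k x; rewrite /hat_fun /= pact1 /= gmulf1 invg1 mulg1. Qed.

Definition hat_paction : partial_action G (K * X) :=
  PartialAction hat_funV hat_funM hat_fun1.

End HatAction.

Definition hat_in (H : topologicalGroupType) (G : groupClosed H) (X : Type)
    (m : partial_action (subgroup G) X) :
    partial_action (subgroup G) (H * X) :=
  hat_paction (val : subgroup G -> H) m.

Definition hat_self (G : groupType) (X : Type) (m : partial_action G X) :
    partial_action G (G * X) :=
  hat_paction (@idfun G) m.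

Definition orbit_graph (G : groupType) (Z : Type) (m : partial_action G Z) :
    set (Z * Z) :=
  [set p | orbit_rel m p.1 p.2].

Definition compatible_metric (R : realType) (X : topologicalType)
    (d : X -> X -> R) : Prop :=
  [/\ forall x y, (0 <= d x y)%R,
      forall x y, d x y = 0%R <-> x = y,
      forall x y, d x y = d y x,
      forall x y z, (d x z <= d x y + d y z)%R &
      forall x (U : set X),
        nbhs x U <-> exists2 e : R, (0 < e)%R & [set y | (d x y < e)%R] `<=` U].

(* Main.v *)
(* The partial action on H * X is by open maps, so the projection to the orbit
   space is open and regularity amounts to closing up the saturation of a small
   neighbourhood of (h, x) inside the saturation of a given one.  If the orbits
   of W * A accumulate at (k, y), the group elements involved are all close to a
   single g0, and g . a = g0 . b with b close to x; so y is in the closure of a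
   translate g0 . B', and each of the three conditions ensures that g0^-1 . y is
   then defined and close to x. *)
Require Import Defs.
From mathcomp Require Import all_boot all_order all_algebra.
From mathcomp Require Import all_classical all_reals all_analysis.

Set Implicit Arguments.
Unset Strict Implicit.
Unset Printing Implicit Defensive.

Local Open Scope classical_set_scope.

Definition pact_image (G : groupType) (X : Type) (m : partial_action G X)
    (g : G) (A : set X) : set X :=
  [set y | exists2 x, A x & m g x = Some y].

Definition saturation (G : groupType) (X : Type) (m : partial_action G X)
    (A : set X) : set X :=
  [set y | exists2 x, A x & orbit_rel m x y].

(** Openness of the maps [m g] and of their ranges in one condition: [A := setT] shows that
    [pact_set m g] is a neighbourhood of each of its points. *)
Definition locally_open_paction (G : groupType) (Z : topologicalType)
    (m : partial_action G Z) : Prop :=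
  forall g (z w : Z) A, m g z = Some w -> nbhs z A -> nbhs w (pact_image m g A).

Section OrbitSpace.
Variables (G : groupType) (Z : topologicalType) (m : partial_action G Z).

Let Q := orbit_space m.
Let p : Z -> Q := \pi_Q%qT.

Let p_eq z w : p z = p w <-> orbit_rel m z w.
Proof.
by split=> [/eqmodP/asboolP|zw] //; apply/eqmodP/asboolP.
Qed.

Lemma nbhs_orbit_space (z : Z) A : locally_open_paction m ->
  nbhs z A -> nbhs (p z) (p @` A).
Proof.
move=> mo; rewrite nbhsE => -[U [oU Uz] UA].
rewrite nbhsE; exists (p @` U); last exact: image_subset.
split; last by exists z.
change (open (p @^-1` (p @` U))).
rewrite openE => w /= [u Uu /p_eq[g gu]].
apply: filterS (mo g u w U gu (open_nbhs_nbhs (conj oU Uu))) => y [x Ux gx].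
by exists x => //; apply/p_eq; exists g.
Qed.

Lemma orbit_space_regular : locally_open_paction m ->
  (forall (z : Z) V, nbhs z V -> exists2 U, nbhs z U &
     closure (saturation m U) `<=` saturation m V) ->
  regular_space Q.
Proof.
move=> mo satP q O qO.
have pK : p (repr q) = q by exact: reprK.
have /satP[U Uz UO] : nbhs (repr q : Z) (p @^-1` O).
  by apply: pi_continuous; rewrite -/p pK.
exists (p @` U); first by rewrite -pK; exact: nbhs_orbit_space.
move=> r rU; have pr : p (repr r) = r by exact: reprK.
have [|v /= Ov /p_eq vr] := UO (repr r); last by rewrite -pr -vr.
(* [p] is open, so [p @] M[is a neighbourhood of]r[and meets]p @[U]; the common orbit puts a point
   of [M] in the saturation of [U]. *)
move=> M rM; have [] := rU (p @` M).
  by rewrite -pr; exact: nbhs_orbit_space.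
move=> _ [[u Uu <-] [w Mw /esym/p_eq uw]].
by exists w; split => //; exists u.
Qed.

End OrbitSpace.

(** The translate of [A] by [g] is the preimage of [A] under the action of [g^-1], which is
    continuous on an open domain. *)
Lemma topological_paction_locally_open (G : topologicalGroupType)
    (X : topologicalType) (m : partial_action G X) :
  topological_paction m -> locally_open_paction m.
Proof.
move=> [Xo homeo] g x y A gx Ax.
have gy := pactV gx.
have [_ + _] := homeo (g^-1)%g; rewrite continuous_open_subspace; last exact: Xo.
have yD : pact_set m (g^-1)^-1%g y by rewrite /pact_set /= invgK gy.
move=> /(_ y); rewrite inE => /(_ yD) cy.
have Ay : nbhs y (pact_map_at m g^-1%g @^-1` A).
  by apply: cy; rewrite /pact_map_at /pact_map /= gy.
(* Outside this set [pact_map_at] returns its default value, which may lie in [A] by accident. *)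
have Dy : nbhs y (pact_set m (g^-1)^-1%g) by apply: open_nbhs_nbhs; split.
apply: filterS2 Ay Dy => w.
rewrite /pact_map_at /pact_map /pact_set /= invgK.
case E : (m g^-1%g w) => [v|] //= Av _.
by exists v => //; rewrite -[g]invgK; exact: pactV.
Qed.

Section TopologicalGroup.
Variables (H : topologicalGroupType) (T : topologicalType).

Lemma continuous_mulg (f f' : T -> H) t : {for t, continuous f} ->
  {for t, continuous f'} -> {for t, continuous (fun s => f s * f' s)%g}.
Proof.
move=> ft f't; apply: (@continuous_comp _ _ _ (fun s => (f s, f' s))
  (fun p => p.1 * p.2)%g); last exact: mulg_continuous.
exact: cvg_pair.
Qed.

Lemma continuous_invg (f : T -> H) t :
  {for t, continuous f} -> {for t, continuous (fun s => (f s)^-1)%g}.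
Proof. by move=> ft; apply: continuous_comp => //; exact: invg_continuous. Qed.

End TopologicalGroup.

Section HatAction.
Variables (H : topologicalGroupType) (G : groupClosed H) (X : topologicalType).
Variable m : partial_action (subgroup G) X.

Lemma hat_inP (g : subgroup G) (k l : H) (x y : X) :
  hat_in m g (k, x) = Some (l, y) <-> l = (k * (val g)^-1)%g /\ m g x = Some y.
Proof.
rewrite /hat_in /hat_paction /=; case: (m g x) => [z|] /=.
  by split=> [[<- <-]|[-> [->]]].
by split=> // -[].
Qed.

(** On the factor [H] the action is right translation, a homeomorphism, so a box goes to a box. *)
Lemma hat_in_locally_open : locally_open_paction m ->
  locally_open_paction (hat_in m).
Proof.
move=> mo g [k x] [l y] A /hat_inP[-> gx] [[P B] /= [Pk Bx] PBA].
have Pl : nbhs (k * (val g)^-1)%g [set l' | P (l' * val g)%g].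
  have ct : {for (k * (val g)^-1)%g, continuous (fun l' : H => l' * val g)%g}.
    by apply: continuous_mulg; [exact: cvg_id | exact: cvg_cst].
  by apply: ct; rewrite mulgVK.
exists ([set l' | P (l' * val g)%g], pact_image m g B).
  by split => //=; exact: mo gx Bx.
move=> [l' y'] [/= Pl' [b Bb gb]].
exists (l' * val g, b)%g; first exact: PBA.
by apply/hat_inP; rewrite mulgK.
Qed.

(* What conditions (1), (2) and (3) are used for. *)
Definition shrinks_translates : Prop := forall (x : X) B, nbhs x B ->
  exists2 B', nbhs x B' &
    forall g, closure (pact_image m g B') `<=` pact_image m g B.

(** A limit [y] of [g . B'] stays in the closed set [pact_set m g], so [g^-1 . y] is defined; by
    openness of [m g] it lies in the closure of [B']. *)
Lemma closed_pact_set_shrinks : regular_space X -> locally_open_paction m ->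
  (forall g, closed (pact_set m g)) -> shrinks_translates.
Proof.
move=> Xr mo Xc x B /Xr[B' B'x B'B]; exists B' => // g y yB'.
have : pact_set m g y.
  apply: (Xc g) => M /yB'[z [[b _ gb] Mz]].
  by exists z; split => //; rewrite /pact_set /= (pactV gb).
rewrite /pact_set /=; case E : (m g^-1%g y) => [b|] // _.
have gb := pactV E; rewrite invgK in gb.
exists b => //; apply: B'B => M bM.
have [z [[c B'c gc] [d Md gd]]] := yB' _ (mo _ _ _ _ gb bM).
by exists d; split => //; move: (pactV gc) (pactV gd) B'c => -> [->].
Qed.

(* If [g . b] accumulates at y with b in a relatively compact set, then b
   accumulates at some a, and the related pairs [(1, b) ~ (g^-1, g . b)]
   accumulate at [(1, a), (g^-1, y)]. *)
Lemma closed_graph_shrinks : regular_space X -> locally_compact [set: X] ->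
  closed (orbit_graph (hat_self m)) -> shrinks_translates.
Proof.
move=> Xr Xlc Gc x B Bx.
have [C] := Xlc x I; rewrite withinET => Cx [Cc Ccl].
have [B' B'x B'B] := Xr x _ (filterI Bx Cx).
exists B' => // g y yB'.
have cB' : compact (closure B').
  by apply: subclosed_compact Cc _; [exact: closed_closure | move=> ? /B'B[]].
(* The filter of those [b] in [B'] for which [g . b] tends to [y]. *)
pose F := pact_map_at m g^-1%g @ within (pact_image m g B') (nbhs y).
have FF : ProperFilter F.
  by apply: fmap_proper_filter; exact: within_nbhs_proper.
have gK b z : m g b = Some z -> pact_map_at m g^-1%g z = b.
  by move=> gb; rewrite /pact_map_at /pact_map /= (pactV gb).
have [|a [B'a aF]] := cB' F FF.
  apply: (@filterE _ (nbhs y)) => z [b B'b gb]; rewrite /= (gK _ _ gb).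
  exact: subset_closure.
have [g' /=] : orbit_graph (hat_self m) ((1%g, a), (g^-1%g, y)).
  apply: Gc => S [[S1 S2] /= [[[P1 P2] /= [P1n P2n] P12]
    [[P3 P4] /= [P3n P4n] P34]] S12].
  have [|b [[z [gBz P4z] zb] P2b]] := aF
    [set b | exists2 z, (pact_image m g B' `&` P4) z & pact_map_at m g^-1%g z = b]
    P2 _ P2n.
    by apply: filterS P4n => z P4z gz; exists z.
  case: gBz => c B'c gc; move: zb; rewrite (gK _ _ gc) => cb; subst c.
  exists ((1%g, b), (g^-1%g, z)); split.
    by exists g; rewrite /= gc /= mul1g.
  apply: S12; split; [apply: P12|apply: P34]; split => //=; exact: nbhs_singleton.
(* The group coordinate [g^-1] forces [g' = g], hence [g . a = y]. *)
case E : (m g' a) => [w|] //= /Some_inj/pair_equal_spec[].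
rewrite mul1g => /invg_inj g'g <-; rewrite -g'g.
by exists a => //; have [] := B'B _ B'a.
Qed.

(** Continuity of the action at [(1, x)], an interior point of its domain with value [x]. *)
Lemma continuous_paction_near (x : X) B : continuous_paction m ->
  open (pact_dom m) -> nbhs x B ->
  exists2 E, nbhs (1%g : H) E & exists2 A, nbhs x A &
    forall (u : subgroup G) a, E (val u) -> A a -> exists2 b, B b & m u a = Some b.
Proof.
move=> [_ mc] mo Bx.
have D1 : pact_dom m (1%g, x) by rewrite /pact_dom /= pact1.
move: mc; rewrite continuous_open_subspace// => /(_ (1%g, x)).
rewrite inE => /(_ D1) mc.
have mB : nbhs (1%g, x) (pact_map m @^-1` B).
  by apply: mc; rewrite /pact_map /= pact1.
have [[E A] /= [E1 Ax] EA] := filterI mB (open_nbhs_nbhs (conj mo D1)).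
have [E' [[E0 oE0 E0E'] E'1] E'E] : exists2 E', open_nbhs 1%g E' & E' `<=` E.
  by move: E1; rewrite nbhsE.
exists E0; first by apply: open_nbhs_nbhs; split => //; move: E'1; rewrite -E0E'.
exists A => // u a E0u Aa.
have /EA[] : (E `*` A) (u, a) by split => //=; apply: E'E; rewrite -E0E'.
by rewrite /pact_map /pact_dom /=; case: (m u a) => [b|] // Bb _; exists b.
Qed.

(* If [k0 = h0 g0^-1] and [k1 = h1 g1^-1] are both close to k, with h0 and h1 in
   a small set W, then [u = g0^-1 g1 = h0^-1 (k0 k1^-1) h1] is close to 1, and
   [g1 a = g0 (u a)] with [u a] close to x. *)
Lemma hat_in_saturation_closure (z : H * X) V : continuous_paction m ->
  open (pact_dom m) -> shrinks_translates -> nbhs z V ->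
  exists2 U, nbhs z U &
    closure (saturation (hat_in m) U) `<=` saturation (hat_in m) V.
Proof.
case: z => h x mc mo ms [[P B] /= [Ph Bx] PBV].
have [B' B'x B'B] := ms _ _ Bx.
have [E E1 [A Ax EA]] := continuous_paction_near mc mo B'x.
have [[Y W2] /= [[[W1 N1] /= [W1h N1i] WNY] W2h] YWE] : nbhs (h, 1%g, h)
    [set t : H * H * H | E (t.1.1^-1 * t.1.2 * t.2)%g].
  have ct : {for (h, 1%g, h),
      continuous (fun t : H * H * H => t.1.1^-1 * t.1.2 * t.2)%g}.
    apply: continuous_mulg; last exact: cvg_snd.
    apply: continuous_mulg.
      apply: continuous_invg; apply: (@continuous_comp _ _ _ fst fst);
        exact: cvg_fst.
    by apply: (@continuous_comp _ _ _ fst snd); [exact: cvg_fst | exact: cvg_snd].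
  by apply: ct; rewrite /= mulg1 mulVg.
(* Serves the final step, where [k * val g0 = (k * k0^-1) * h0] has to lie in [P]. *)
have [[N2 W3] /= [N2i W3h] WP] : nbhs (1%g, h) [set t : H * H | P (t.1 * t.2)%g].
  by apply: mulg_continuous; rewrite /= mul1g.
pose W := W1 `&` W2 `&` W3; pose N := N1 `&` N2.
exists (W `*` A).
  exists (W, A) => //=; split => //=; exact: filterI (filterI W1h W2h) W3h.
move=> [k y] ky.
have [K Kk KN] : exists2 K, nbhs k K &
    forall k1 k2, K k1 -> K k2 -> N (k1 * k2^-1)%g.
  have [[K1 K2] /= [K1k K2k] KN] : nbhs (k, k) [set t : H * H | N (t.1 * t.2^-1)%g].
    have ct : {for (k, k), continuous (fun t : H * H => t.1 * t.2^-1)%g}.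
      apply: continuous_mulg; first exact: cvg_fst.
      by apply: continuous_invg; exact: cvg_snd.
    by apply: ct; rewrite /= mulgV; exact: filterI.
  exists (K1 `&` K2); first exact: filterI.
  by move=> k1 k2 [? _] [_ ?]; exact: (KN (k1, k2)).
have kyM M : nbhs y M -> nbhs (k, y) (K `*` M) by move=> yM; exists (K, M).
(* [g0] is fixed before the neighbourhood [M] of [y] varies, so that [y] is a limit of one single
   translate. *)
have [[k0 y0] [[[h0 a0] [Wh0 _] [g0 /hat_inP[k0E _]]] [/= Kk0 _]]] :=
  ky _ (kyM setT filterT).
have /B'B[b Bb gb] : closure (pact_image m g0 B') y.
  move=> M yM.
  have [[k1 y1] [[[h1 a1] [Wh1 Aa1] [g1 /hat_inP[k1E ga1]]] [/= Kk1 My1]]] :=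
    ky _ (kyM M yM).
  have uE : E (val (g0^-1 * g1)%g).
    have -> : val (g0^-1 * g1)%g = (h0^-1 * (k0 * k1^-1) * h1)%g.
      by rewrite k0E k1E valM gmulfV invgM invgK !mulgA mulVg mul1g mulgVK.
    apply: (YWE (h0, k0 * k1^-1, h1)%g).
    case: Wh0 => [[? _] _]; case: Wh1 => [[_ ?] _].
    by split => //; apply: WNY; split => //; case: (KN _ _ Kk0 Kk1).
  have [c B'c uc] := EA _ _ uE Aa1.
  exists y1; split => //; exists c => //.
  have := pactM (pactV uc) ga1.
  by rewrite invgM invgK mulgA mulgV mul1g.
exists (k * val g0, b)%g; last by exists g0; apply/hat_inP; rewrite mulgK.
apply: PBV; split => //=.
have -> : (k * val g0 = (k * k0^-1) * h0)%g.
  by rewrite k0E invgM invgK mulgA mulgVK.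
apply: (WP (k * k0^-1, h0)%g); split => /=; last by case: Wh0.
by case: (KN _ _ (nbhs_singleton Kk) Kk0).
Qed.

End HatAction.

Theorem theorem4p6 (R : realType) (H : topologicalGroupType)
    (G : groupClosed H) (X : topologicalType)
    (m : partial_action (subgroup G) X)
    (X_regular : regular_space X)
    (m_continuous : continuous_paction m)
    (m_open : open (pact_dom m))
    (hyp :
      [\/ forall g : subgroup G, closed (pact_set m g),
          [/\ exists d : X -> X -> R, compatible_metric d,
              locally_compact [set: X]
            & closed (orbit_graph (hat_self m))]
        | [/\ compact [set: X], hausdorff_space X
            & closed (orbit_graph (hat_self m))]]) :
  regular_space (orbit_space (hat_in m)).
Proof.
have mo : locally_open_paction m.
  by apply: topological_paction_locally_open; case: m_continuous.
apply: orbit_space_regular; first exact: hat_in_locally_open.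
move=> z V; apply: hat_in_saturation_closure => //.
case: hyp => [Xc|[_ Xlc Gc]|[Xc _ Gc]].
- exact: closed_pact_set_shrinks.
- exact: closed_graph_shrinks.
(* In a compact space the whole space is a closed compact neighbourhood of each point. *)
- apply: closed_graph_shrinks => // x _; rewrite withinET.
  by exists setT; [exact: filterT | split => //; exact: closedT].
Qed.
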